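(* Let $N$ be a power of 2. Consider recursive matrix multiplication of two $N\times N$ matrices with temporary reuse, in which the two temporaries of each addition group are freed after the group's sum has been stored in the corresponding block of $C$, and freed memory is reused by later allocations. Its Data Movement Distance $\mathrm{DGC}^{up}_{RMM}$ satisfies the upper bound $$\sim(\mathrm{DGC}^{up}_{RMM}) < 11.85\,N^{10/3}.$$
   Context: Recursive matrix multiplication $\mathrm{rmm}(A,B)$ on $n\times n$ matrices, $n$ a power of 2, is defined as follows. If $n=1$ it computes $C_{11}=A_{11}B_{11}$. Otherwise it splits into $\frac n2\times\frac n2$ blocks and computes, in order, the four addition groups $C_{11}=\mathrm{rmm}(A_{11},B_{11})+\mathrm{rmm}(A_{12},B_{21})$, $C_{12}=\mathrm{rmm}(A_{11},B_{12})+\mathrm{rmm}(A_{12},B_{22})$, $C_{21}=\mathrm{rmm}(A_{21},B_{11})+\mathrm{rmm}(A_{22},B_{21})$, $C_{22}=\mathrm{rmm}(A_{21},B_{12})+\mathrm{rmm}(A_{22},B_{22})$. Here $C$ is a newly allocated matrix, and each recursive call returns a temporary matrix. In the temporary-reuse version, the two temporaries of each addition group are freed after that group's addition, so the total data footprint, including inputs and output, is at most $4N^2$ locations. The reuse distance of an access is the number of distinct memory locations accessed between the previous access to the same location and the current one, inclusive. The Data Movement Distance is $\sum_i\sqrt{d_i}$ over all accesses with reuse distance $d_i$; this is LRU stack cost with position $k$ costing $\sqrt{k}$. $\sim(\cdot)$ denotes asymptotic equivalence as $N\to\infty$, keeping the leading coefficient. *)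

(* Defs.v *)
From mathcomp Require Import all_boot all_order all_algebra.
From mathcomp Require Import reals.

Set Implicit Arguments.
Unset Strict Implicit.
Unset Printing Implicit Defensive.

(** * Reuse distance and Data Movement Distance *)

(* Access number [i] of the trace [t] (numbered from 0) goes to a location that
   has been accessed before. *)
Definition reaccess (t : seq nat) (i : nat) : bool :=
  nth 0 t i \in take i t.

(* [rev (take i t)] lists the accesses preceding access [i], latest first, so
   [index] finds the latest access to the same location.  The window runs from
   that access up to access [i - 1]; access [i] itself adds no new location, so
   counting it or not ("inclusive") gives the same number.  Only meaningful
   when [reaccess t i] holds. *)
Definition reuse_distance (t : seq nat) (i : nat) : nat :=
  let past := rev (take i t) in
  size (undup (take (index (nth 0 t i) past).+1 past)).

(* The first access to a location has no reuse distance and is not counted. *)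
Definition dmd (R : realType) (t : seq nat) : R :=
  (\sum_(i < size t | reaccess t i) Num.sqrt (reuse_distance t i)%:R)%R.

(** * Recursive matrix multiplication with temporary reuse *)

(* Only the memory behaviour matters: a matrix is given by the memory location
   of each of its entries. *)
Definition layout := nat -> nat -> nat.

Definition block (m : nat) (A : layout) (p q : nat) : layout :=
  fun i j => A (p * m + i) (q * m + j).

Definition row_major (n : nat) (s : seq nat) : layout :=
  fun i j => nth 0 s (i * n + j).

Definition entries (n : nat) : seq (nat * nat) :=
  [seq (i, j) | i <- iota 0 n, j <- iota 0 n].

Definition locations (n : nat) (A : layout) : seq nat :=
  [seq A ij.1 ij.2 | ij <- entries n].

(* [heap_free] lists the freed locations, most recently freed first; no
   location [>= heap_fresh] has ever been handed out. *)
Record heap := Heap { heap_free : seq nat; heap_fresh : nat }.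

(* Freed locations are reused, the most recently freed ones first; fresh
   memory is taken only when the freed locations do not suffice. *)
Definition alloc (n : nat) (h : heap) : layout * heap :=
  let s := n * n in
  let missing := s - size (heap_free h) in
  (row_major n (take s (heap_free h) ++ iota (heap_fresh h) missing),
   Heap (drop s (heap_free h)) (heap_fresh h + missing)).

Section RMM.

(* [scan m] is the order in which the entries of an m x m sum are computed;
   [arrange] is the order in which locations freed together are put back on
   the free list. *)
Variables (scan : nat -> seq (nat * nat)) (arrange : seq nat -> seq nat).

Definition free_temporaries (m : nat) (T1 T2 : layout) (h : heap) : heap :=
  Heap (arrange (locations m T1 ++ locations m T2) ++ heap_free h)
       (heap_fresh h).

(* The accesses of C = T1 + T2. *)
Definition add_trace (m : nat) (T1 T2 C : layout) : seq nat :=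
  flatten [seq [:: T1 ij.1 ij.2; T2 ij.1 ij.2; C ij.1 ij.2] | ij <- scan m].

(* [rmm k A B h] multiplies two 2^k x 2^k matrices, starting from heap [h]; it
   returns the accesses made, the result matrix, and the final heap.  The
   result of a recursive call is a temporary of the caller. *)
Fixpoint rmm (k : nat) (A B : layout) (h : heap) : seq nat * layout * heap :=
  let '(C, h0) := alloc (2 ^ k) h in
  match k with
  | 0 => ([:: A 0 0; B 0 0; C 0 0], C, h0)
  | k'.+1 =>
      let m := 2 ^ k' in
      let group p q h :=
        let '(t1, T1, h1) := rmm k' (block m A p 0) (block m B 0 q) h in
        let '(t2, T2, h2) := rmm k' (block m A p 1) (block m B 1 q) h1 in
        (t1 ++ t2 ++ add_trace m T1 T2 (block m C p q),
         free_temporaries m T1 T2 h2) in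
      let '(t11, h11) := group 0 0 h0 in
      let '(t12, h12) := group 0 1 h11 in
      let '(t21, h21) := group 1 0 h12 in
      let '(t22, h22) := group 1 1 h21 in
      (t11 ++ t12 ++ t21 ++ t22, C, h22)
  end.

(* The two inputs occupy the locations 0, ..., 2 N^2 - 1 with N = 2^k. *)
Definition rmm_trace (k : nat) : seq nat :=
  let N := 2 ^ k in
  let A := row_major N (iota 0 (N * N)) in
  let B := row_major N (iota (N * N) (N * N)) in
  (rmm k A B (Heap [::] (2 * (N * N)))).1.1.

End RMM.

(* Main.v *)
(* A call on n x n matrices, n = 2^k, touches at most 4 n^2 locations: its
   inputs and the first 2 n^2 locations its heap hands out, since the
   temporaries of a group go back to the front of the free list.  Inside a
   trace, an access whose previous access lies in the same recursive call keeps
   its reuse distance.  Only the first accesses of a call to its O(n^2)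
   locations are charged anew by the caller, each at most sqrt (4 (2n)^2), and
   the sums cost O(n^3).  Hence D(2n) <= 8 D(n) + O(n^3), so
   D(N) = O(N^3 log N) = o(N^(10/3)), whatever the scan order of the sums and
   the arrangement of the free list. *)
Require Import Defs.
From mathcomp Require Import all_boot all_order all_algebra.
From mathcomp Require Import reals constructive_ereal sequences exp.
From mathcomp Require Import classical_sets ereal topology normedtype.
From mathcomp Require Import ring lra zify.

Import Order.TTheory GRing.Theory Num.Theory.
Local Open Scope ring_scope.

(** * Reuse distances under concatenation of traces *)

Lemma take_size_catD (T : Type) (s t : seq T) (i : nat) :
  take (size s + i) (s ++ t) = s ++ take i t.
Proof. by rewrite take_cat ltnNge leq_addr /= addKn. Qed.

Lemma nth_size_catD (T : Type) (x0 : T) (s t : seq T) (i : nat) :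
  nth x0 (s ++ t) (size s + i) = nth x0 t i.
Proof. by rewrite nth_cat ltnNge leq_addr /= addKn. Qed.

Lemma reaccess_catl (s t : seq nat) (i : nat) :
  (i < size s)%N -> reaccess (s ++ t) i = reaccess s i.
Proof. by move=> lt_i; rewrite /reaccess nth_cat lt_i takel_cat // ltnW. Qed.

Lemma reuse_distance_catl (s t : seq nat) (i : nat) :
  (i < size s)%N -> reuse_distance (s ++ t) i = reuse_distance s i.
Proof.
by move=> lt_i; rewrite /reuse_distance nth_cat lt_i takel_cat // ltnW.
Qed.

(** The previous access lies inside [t], so the backward search stops before reaching [s]. *)
Lemma reuse_distance_catr (s t : seq nat) (i : nat) :
  reaccess t i -> reuse_distance (s ++ t) (size s + i) = reuse_distance t i.
Proof.
rewrite /reaccess /reuse_distance nth_size_catD take_size_catD rev_cat => it.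
by rewrite index_cat mem_rev it takel_cat // index_mem mem_rev.
Qed.

Lemma reuse_distance_le_size (t U : seq nat) (i : nat) :
  {subset t <= U} -> (reuse_distance t i <= size U)%N.
Proof.
move=> tU; apply: uniq_leq_size; first exact: undup_uniq.
move=> x; rewrite mem_undup => /mem_take; rewrite mem_rev => /mem_take.
exact: tU.
Qed.

(** Every location has exactly one first access. The induction appends at the end because [reaccess]
    only looks at the prefix; [x] is then moved to the front, where [undup] tests membership. *)
Lemma sum_first_accesses (t : seq nat) :
  (\sum_(i < size t | ~~ reaccess t i) 1 = size (undup t))%N.
Proof.
elim/last_ind: t => [|t x IHt]; first by rewrite big_ord0.
have -> : size (undup (rcons t x)) = size (undup (x :: t)).
  by apply/perm_size/perm_undup => y; rewrite mem_rcons.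
rewrite size_rcons big_mkcond big_ord_recr -big_mkcond /=.
rewrite (eq_bigl (fun i : 'I_(size t) => ~~ reaccess t i)); last first.
  by move=> i /=; rewrite -cats1 reaccess_catl.
rewrite IHt /reaccess nth_rcons ltnn eqxx -cats1 take_size_cat //.
by case: (x \in t); rewrite ?addn0 ?addn1.
Qed.

(** * Data movement of traces confined to at most [r ^ 2] locations *)

Section Dmd.
Variable R : realType.
Implicit Types (s t U : seq nat) (r : nat).

Lemma sqrt_reuse_distance_le t U r i :
  {subset t <= U} -> (size U <= r ^ 2)%N ->
  Num.sqrt (reuse_distance t i)%:R <= r%:R :> R.
Proof.
move=> tU Ur; have := leq_trans (reuse_distance_le_size _ _ i tU) Ur.
by rewrite -(ler_nat R) => /ler_wsqrtr; rewrite natrX sqrtr_sqr normr_nat.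
Qed.

Lemma dmd_le_size t U r :
  {subset t <= U} -> (size U <= r ^ 2)%N ->
  dmd R t <= (size t * r)%:R.
Proof.
move=> tU Ur; rewrite /dmd big_mkcond natrM mulr_natl.
rewrite -[in leRHS](card_ord (size t)) -sumr_const.
apply: ler_sum => i _; case: ifP => // _.
exact: sqrt_reuse_distance_le tU Ur.
Qed.

(** Only the first accesses within [t] can become costlier after [s]. There is one per location,
    hence at most [r ^ 2] of them, and each costs at most [r]. *)
Lemma dmd_cat_le s t U r :
  {subset s ++ t <= U} -> (size U <= r ^ 2)%N ->
  dmd R (s ++ t) <= dmd R s + dmd R t + (r ^ 3)%:R.
Proof.
move=> stU Ur; rewrite {1}/dmd size_cat big_split_ord /= -addrA; apply: lerD.
  rewrite le_eqVlt; apply/orP; left; apply/eqP.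
  apply: eq_big => [i|i _]; first exact: reaccess_catl.
  by rewrite reuse_distance_catl.
apply: (@le_trans _ _
  (dmd R t + \sum_(i < size t | ~~ reaccess t i) r%:R)).
  rewrite /dmd big_mkcond [X in _ <= X + _]big_mkcond.
  rewrite [X in _ <= _ + X]big_mkcond -big_split /=.
  apply: ler_sum => i _; case: ifPn => it /=.
    case: ifPn => jt; last by rewrite add0r (sqrt_reuse_distance_le _ U).
    by rewrite reuse_distance_catr ?addr0.
  by apply: addr_ge0; case: ifP => // _; rewrite sqrtr_ge0.
rewrite lerD2l (eq_bigr (fun=> (r * 1)%N%:R)) => [|i _]; last by rewrite muln1.
rewrite -natr_sum -big_distrr /= sum_first_accesses.
rewrite ler_nat expnS leq_mul2l.
apply/orP; right; apply: leq_trans Ur.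
apply: uniq_leq_size; first exact: undup_uniq.
by move=> x; rewrite mem_undup => xt; apply: stU; rewrite mem_cat xt orbT.
Qed.

Lemma dmd_flatten_le (ss : seq (seq nat)) U r :
  {subset flatten ss <= U} -> (size U <= r ^ 2)%N ->
  dmd R (flatten ss) <= \sum_(s <- ss) dmd R s + (size ss * r ^ 3)%:R.
Proof.
move=> sub Ur; elim: ss sub => [|s ss IH] sub.
  by rewrite /dmd big_ord0 big_nil add0r ler0n.
have {}IH : dmd R (flatten ss) <= \sum_(s <- ss) dmd R s + (size ss * r ^ 3)%:R.
  by apply: IH => x xss; apply: sub; rewrite mem_cat xss orbT.
have := dmd_cat_le _ _ _ _ sub Ur.
rewrite /= big_cons mulSn natrD; lra.
Qed.

End Dmd.

(** * Heap order and the locations of a layout *)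

(* The next [q] locations that allocation would hand out from [h]. *)
Definition available (q : nat) (h : heap) : seq nat :=
  take q (heap_free h) ++ iota (heap_fresh h) (q - size (heap_free h)).

Lemma size_available q h : size (available q h) = q.
Proof. rewrite size_cat size_take_min size_iota; lia. Qed.

Lemma available_subset (p q : nat) (h : heap) :
  (p <= q)%N -> {subset available p h <= available q h}.
Proof.
move=> pq x; rewrite !mem_cat => /orP[|]; last first.
  by rewrite !mem_iota => ?; apply/orP; right; lia.
by rewrite -(@subnK p q) // addnC takeD mem_cat => ->.
Qed.

Lemma available_alloc (n q : nat) (h : heap) :
  {subset available q (alloc n h).2 <= available (q + n * n) h}.
Proof.
move=> x; rewrite /available /= !mem_cat size_drop.
rewrite [(q + _)%N]addnC takeD mem_cat.
case/orP => [->|]; first by rewrite orbT.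
by rewrite !mem_iota => ?; apply/orP; right; lia.
Qed.

Lemma available_free (q : nat) (F s : seq nat) (f : nat) :
  available (size s + q) (Heap (s ++ F) f) = s ++ available q (Heap F f).
Proof. by rewrite /available /= take_size_catD size_cat subnDl catA. Qed.

Lemma mem_entries n i j : ((i, j) \in entries n) = (i < n)%N && (j < n)%N.
Proof.
apply/allpairsP/andP => [[[a b]] /= [+ + [-> ->]]|[lt_i lt_j]].
  by rewrite !mem_iota !add0n.
by exists (i, j); rewrite !mem_iota /= !add0n.
Qed.

Lemma size_locations n A : size (locations n A) = (n * n)%N.
Proof. by rewrite size_map size_allpairs size_iota. Qed.

Lemma mem_locations n (A : layout) i j :
  (i < n)%N -> (j < n)%N -> A i j \in locations n A.
Proof.
move=> lt_i lt_j.
apply: (map_f (fun ij => A ij.1 ij.2) (x := (i, j))).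
by rewrite mem_entries lt_i.
Qed.

Lemma locationsP n (A : layout) x :
  reflect (exists i j, [/\ (i < n)%N, (j < n)%N & x = A i j])
          (x \in locations n A).
Proof.
apply: (iffP mapP) => [[[i j]]|[i [j [lt_i lt_j ->]]]].
  by rewrite mem_entries => /andP[lt_i lt_j] ->; exists i, j.
by exists (i, j); rewrite ?mem_entries ?lt_i.
Qed.

Lemma locations_block m (A : layout) p q : (p < 2)%N -> (q < 2)%N ->
  {subset locations m (block m A p q) <= locations (2 * m) A}.
Proof.
move=> p2 q2 x /locationsP[i [j [lt_i lt_j ->]]].
by apply: mem_locations; nia.
Qed.

Lemma locations_alloc n h :
  {subset locations n (alloc n h).1 <= available (n * n) h}.
Proof.
move=> x /locationsP[i [j [lt_i lt_j ->]]].
by apply: (@mem_nth _ 0%N (available (n * n) h)); rewrite size_available; nia.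
Qed.

(* With these, unlike with [!mem_cat], a last segment [available q h] is not
   unfolded into its two parts. *)
Lemma mem_cat3 (T : eqType) (x : T) (s1 s2 s3 : seq T) :
  (x \in s1 ++ s2 ++ s3) = [|| x \in s1, x \in s2 | x \in s3].
Proof. by rewrite !mem_cat. Qed.

Lemma mem_cat4 (T : eqType) (x : T) (s1 s2 s3 s4 : seq T) :
  (x \in s1 ++ s2 ++ s3 ++ s4) =
  [|| x \in s1, x \in s2, x \in s3 | x \in s4].
Proof. by rewrite !mem_cat. Qed.

(** * Memory footprint of a recursive call *)

Section Rmm.
Variables (scan : nat -> seq (nat * nat)) (arrange : seq nat -> seq nat).
Hypothesis scan_entries : forall n : nat, perm_eq (scan n) (entries n).
Hypothesis arrange_perm : forall s : seq nat, perm_eq (arrange s) s.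

Local Notation rmm := (rmm scan arrange).
Local Notation trace k A B h := (rmm k A B h).1.1.
Local Notation result k A B h := (rmm k A B h).1.2.
Local Notation final k A B h := (rmm k A B h).2.

Definition group_trace k A B C p q h :=
  let m := (2 ^ k)%N in
  let A1 := block m A p 0 in let B1 := block m B 0 q in
  let A2 := block m A p 1 in let B2 := block m B 1 q in
  let h1 := final k A1 B1 h in
  trace k A1 B1 h ++ trace k A2 B2 h1 ++
  add_trace scan m (result k A1 B1 h) (result k A2 B2 h1) (block m C p q).

Definition group_final k A B p q h :=
  let m := (2 ^ k)%N in
  let A1 := block m A p 0 in let B1 := block m B 0 q in
  let A2 := block m A p 1 in let B2 := block m B 1 q in
  let h1 := final k A1 B1 h in
  free_temporaries arrange m (result k A1 B1 h) (result k A2 B2 h1)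
    (final k A2 B2 h1).

(** Trades the nested pattern matches for projections, so that each addition group can be treated on
    its own. *)
Lemma rmmS k A B h :
  let C := (alloc (2 ^ k.+1) h).1 in
  let h0 := (alloc (2 ^ k.+1) h).2 in
  let h1 := group_final k A B 0 0 h0 in
  let h2 := group_final k A B 0 1 h1 in
  let h3 := group_final k A B 1 0 h2 in
  rmm k.+1 A B h =
  (group_trace k A B C 0 0 h0 ++ group_trace k A B C 0 1 h1 ++
   group_trace k A B C 1 0 h2 ++ group_trace k A B C 1 1 h3,
   C, group_final k A B 1 1 h3).
Proof.
rewrite /group_trace /group_final [LHS]/=.
by do 8!case: (Defs.rmm _ _ k _ _ _) => [[? ?] ?] /=.
Qed.

Lemma result_rmm k A B h : result k A B h = (alloc (2 ^ k) h).1.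
Proof. by case: k => [|k]; rewrite ?rmmS. Qed.

Lemma size_add_trace m T1 T2 C :
  size (add_trace scan m T1 T2 C) = (3 * (m * m))%N.
Proof.
have -> : (m * m = size (scan m))%N.
  by rewrite (perm_size (scan_entries m)) size_allpairs !size_iota.
by rewrite /add_trace; elim: (scan m) => //= ij s ->; rewrite mulnS.
Qed.

Lemma add_trace_subset m T1 T2 C :
  {subset add_trace scan m T1 T2 C <=
     locations m T1 ++ locations m T2 ++ locations m C}.
Proof.
move=> x /flattenP[s /mapP[[i j]]].
rewrite (perm_mem (scan_entries m)) mem_entries => /andP[lt_i lt_j] ->.
by rewrite !inE !mem_cat => /or3P[] /eqP->; rewrite mem_locations ?orbT.
Qed.

Lemma sqr_exp2 k : (2 ^ k * 2 ^ k = 4 ^ k)%N.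
Proof. by rewrite -expnMn. Qed.

(** Of the [2 * 4 ^ k] heap locations, [4 ^ k] hold the result and the rest leave room for all
    temporaries below it. *)
Definition footprint k A B h : seq nat :=
  locations (2 ^ k) A ++ locations (2 ^ k) B ++ available (2 * 4 ^ k) h.

Lemma size_footprint k A B h : size (footprint k A B h) = ((2 * 2 ^ k) ^ 2)%N.
Proof.
rewrite 2!size_cat !size_locations size_available expnMn -!mulnn sqr_exp2; lia.
Qed.

(** The shift by [4 ^ k] pays for the result, which stays allocated. A lower bound on [q] is imposed
    because a call may permute the front of the free list: the prefix must be long enough to contain
    everything permuted. *)
Definition keeps_available k := forall A B h q r,
  (4 ^ k <= q)%N -> (q + 4 ^ k <= r)%N ->
  {subset available q (final k A B h) <= available r h}.

Definition stays_in_footprint k := forall A B h,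
  {subset trace k A B h <= footprint k A B h}.

Lemma locations_result k A B h :
  {subset locations (2 ^ k) (result k A B h) <= available (4 ^ k) h}.
Proof. by move=> x; rewrite result_rmm -sqr_exp2; apply: locations_alloc. Qed.

(* Freeing puts the [2 * 4 ^ k] locations taken by the two calls back in front,
   so the shifts by [4 ^ k] in [keeps_available] cancel. *)
Lemma available_group_final k A B p q h r : keeps_available k ->
  (3 * 4 ^ k <= r)%N ->
  {subset available r (group_final k A B p q h) <= available r h}.
Proof.
move=> IH le_r x; rewrite /group_final /free_temporaries.
set A1 := block _ A p 0; set B1 := block _ B 0 q.
set A2 := block _ A p 1; set B2 := block _ B 1 q.
set T := locations _ _ ++ locations _ _.
have sT : size (arrange T) = (2 * 4 ^ k)%N.
  rewrite (perm_size (arrange_perm T)) size_cat !size_locations sqr_exp2; lia.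
have {1}-> : r = (size (arrange T) + (r - 2 * 4 ^ k))%N by lia.
rewrite available_free mem_cat (perm_mem (arrange_perm T)) mem_cat.
case/orP => [/orP[]|].
- by move/locations_result; apply: available_subset; lia.
- by move/locations_result; apply: IH; lia.
- have keep1 := IH A1 B1 h (r - 4 ^ k)%N r ltac:(lia) ltac:(lia).
  have := IH A2 B2 (final k A1 B1 h) (r - 2 * 4 ^ k)%N (r - 4 ^ k)%N
    ltac:(lia) ltac:(lia).
  by case: (final k A2 B2 _) => F f keep2 /keep2/keep1.
Qed.

(** The first call needs [2 * 4 ^ k] heap locations. The second needs as many again, but only the
    [4 ^ k] of the first result are still taken, which makes [3 * 4 ^ k]. *)
Lemma group_trace_subset k A B C p q h :
  keeps_available k -> stays_in_footprint k -> (p < 2)%N -> (q < 2)%N ->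
  {subset group_trace k A B C p q h <=
     locations (2 ^ k.+1) A ++ locations (2 ^ k.+1) B ++
     locations (2 ^ k.+1) C ++ available (3 * 4 ^ k) h}.
Proof.
move=> keep stay p2 q2 x; rewrite /group_trace expnS.
set A1 := block _ A p 0; set B1 := block _ B 0 q.
set A2 := block _ A p 1; set B2 := block _ B 1 q.
rewrite [X in _ -> is_true X]mem_cat4 mem_cat3.
case/or3P => [/stay|/stay|/add_trace_subset]; rewrite mem_cat3.
- case/or3P => [/locations_block->|/locations_block->|] //; rewrite ?orbT //.
  by move/available_subset->; rewrite ?orbT //; lia.
- case/or3P => [/locations_block->|/locations_block->|] //; rewrite ?orbT //.
  by move/keep->; rewrite ?orbT //; lia.
- case/or3P => [/locations_result|/locations_result|/locations_block->] //.
  + by move/available_subset->; rewrite ?orbT //; lia.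
  + by move/keep->; rewrite ?orbT //; lia.
  + by rewrite ?orbT.
Qed.

Lemma rmm_keeps_available k : keeps_available k.
Proof.
elim: k => [|k IH] A B h q r le_q le_r x.
  by move/(available_alloc 1); apply: available_subset.
have le3q : (3 * 4 ^ k <= q)%N by rewrite expnS in le_q; lia.
rewrite rmmS; do 4!move/(available_group_final _ _ _ _ _ _ _ IH le3q).
by move/available_alloc; rewrite sqr_exp2; apply: available_subset.
Qed.

(** The result takes [4 ^ k.+1] locations, and all four groups share the next [3 * 4 ^ k], fewer
    than [4 ^ k.+1]. *)
Lemma rmm_stays_in_footprint k : stays_in_footprint k.
Proof.
elim: k => [|k IH] A B h x; rewrite /footprint [X in _ -> is_true X]mem_cat3.
  have tE : trace 0 A B h =i [:: A 0 0; B 0 0; (alloc 1 h).1 0 0]%N by [].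
  rewrite {}tE (mem_seq3 x) => /or3P[] /eqP->.
  - by rewrite mem_locations.
  - by rewrite (@mem_locations _ B) ?orbT.
  - have /locations_alloc := @mem_locations 1 (alloc 1 h).1 0 0 isT isT.
    by move/available_subset->; rewrite ?orbT.
have keep := rmm_keeps_available k.
rewrite rmmS; set C := (alloc _ _).1; set h0 := (alloc _ _).2 => /=.
(* Invariant carried from group to group: each starts with the same pool of temporaries as the
   first. *)
pose near h' := {subset available (3 * 4 ^ k) h' <= available (3 * 4 ^ k) h0}.
have next p q h' : near h' -> near (group_final k A B p q h').
  move=> near_h' y /(available_group_final _ _ _ _ _ _ _ keep (leqnn _)).
  exact: near_h'.
have stay p q h' : x \in group_trace k A B C p q h' ->
    (p < 2)%N -> (q < 2)%N -> near h' ->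
    [|| x \in locations (2 ^ k.+1) A, x \in locations (2 ^ k.+1) B |
        x \in available (2 * 4 ^ k.+1) h].
  move=> + p2 q2 near_h'.
  move/(group_trace_subset _ _ _ _ _ _ _ keep IH p2 q2); rewrite mem_cat4.
  case/or4P => [->|->|/locations_alloc|/near_h'/available_alloc];
    rewrite ?orbT // sqr_exp2 => /available_subset->;
    rewrite ?orbT // expnS; lia.
have near0 : near h0 by [].
have near1 := next 0%N 0%N _ near0; have near2 := next 0%N 1%N _ near1.
have near3 := next 1%N 0%N _ near2.
by rewrite mem_cat4 => /or4P[] /stay; apply.
Qed.

(** * The recurrence for the data movement *)

Variable R : realType.

(** With [r = 2 * 2 ^ k.+1], each of the four groups adds [4 * r ^ 3] to its two recursive calls,
    and joining the groups adds [4 * r ^ 3]. The total [20 * r ^ 3] equals [160 * 8 ^ k.+1], whence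
    the constant 160. *)
Lemma dmd_rmm_le k A B h :
  dmd R (trace k A B h) <= (160 * k.+1 * 8 ^ k)%:R.
Proof.
elim: k A B h => [|k IH] A B h.
  apply: le_trans (dmd_le_size R _ _ _ (rmm_stays_in_footprint 0 A B h) _) _.
    by rewrite size_footprint.
  by rewrite ler_nat.
set r := (2 * 2 ^ k.+1)%N; set U := footprint k.+1 A B h.
have Ur : (size U <= r ^ 2)%N by rewrite size_footprint.
have := rmm_stays_in_footprint k.+1 A B h; rewrite -/U rmmS.
set C := (alloc _ _).1; set h0 := (alloc _ _).2.
set h1 := group_final _ _ _ _ _ h0; set h2 := group_final _ _ _ _ _ h1.
set h3 := group_final _ _ _ _ _ h2 => /=.
have group p q h' : {subset group_trace k A B C p q h' <= U} ->
    dmd R (group_trace k A B C p q h') <=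
    (2 * (160 * k.+1 * 8 ^ k) + 3 * r ^ 3 + r ^ 3)%:R.
  rewrite /group_trace.
  set t1 := trace _ _ _ _; set t2 := trace _ _ _ _.
  set t3 := add_trace _ _ _ _ _ => gU.
  have t3U : {subset t3 <= U}.
    by move=> x xt; apply: gU; rewrite !mem_cat xt !orbT.
  have := dmd_le_size R _ _ _ t3U Ur; rewrite size_add_trace => d3.
  (* The trailing empty list gives the trace the form of a [flatten]. *)
  rewrite -[t3]cats0 in gU.
  have := dmd_flatten_le R [:: t1; t2; t3] U r gU Ur.
  rewrite /= cats0 !big_cons big_nil addr0 => d.
  (* The sum makes [3 * 4 ^ k] accesses, fewer than [r ^ 2 = 16 * 4 ^ k]. *)
  have le3 : (3 * (2 ^ k * 2 ^ k) * r <= r ^ 3)%N.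
    by rewrite [(r ^ 3)%N]expnSr leq_mul2r /r expnS -mulnn; nia.
  rewrite -(ler_nat R) in le3.
  have d1 : dmd R t1 <= _ := IH _ _ _.
  have d2 : dmd R t2 <= _ := IH _ _ _.
  move: d d1 d2 d3 le3.
  rewrite (natrD _ (_ + _)) (natrD _ (2 * _)).
  rewrite (natrM _ 2%N) (natrM _ 3%N (r ^ 3)); lra.
rewrite -[X in _ ++ _ ++ _ ++ X]cats0 => sub.
have := dmd_flatten_le R [:: _; _; _; _] U r sub Ur.
rewrite /= !big_cons big_nil addr0 => d.
apply: le_trans d _.
have mem1 (t1 t2 : seq nat) : {subset t1 ++ t2 <= U} -> {subset t1 <= U}.
  by move=> tU x xt; apply: tU; rewrite mem_cat xt.
have mem2 (t1 t2 : seq nat) : {subset t1 ++ t2 <= U} -> {subset t2 <= U}.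
  by move=> tU x xt; apply: tU; rewrite mem_cat xt orbT.
have /group d1 := mem1 _ _ sub; move/mem2: sub => sub.
have /group d2 := mem1 _ _ sub; move/mem2: sub => sub.
have /group d3 := mem1 _ _ sub; move/mem2: sub => sub.
have /group d4 := mem1 _ _ sub.
have -> : (160 * k.+2 * 8 ^ k.+1 =
    4 * (2 * (160 * k.+1 * 8 ^ k) + 3 * r ^ 3 + r ^ 3) + 4 * r ^ 3)%N.
  have -> : (r ^ 3 = 64 * 8 ^ k)%N.
    rewrite /r (expnS 2 k) mulnA expnMn -(expnM 2 k 3).
    by rewrite (mulnC k) (expnM 2 3 k).
  by rewrite expnS; lia.
move: d1 d2 d3 d4; rewrite (natrD _ (4 * _)) (natrM _ 4%N (_ + _)); lra.
Qed.

End Rmm.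

(** * Asymptotic comparison with the power 10/3 *)

(** The upper limit is an infimum of suprema over eventual sets, so the tail from [K] on already
    bounds it. *)
Lemma limn_esup_le (R : realType) (u : nat -> \bar R) (c : \bar R) (K : nat) :
  (forall k, (K <= k)%N -> u k <= c)%E -> (limn_esup u <= c)%E.
Proof.
move=> uc; rewrite /limn_esup /limf_esup.
apply: (@le_trans _ _ (ereal_sup (u @` [set k | (K <= k)%N])%classic)).
  apply: ereal_inf_lbound => /=; exists [set k | (K <= k)%N]%classic => //.
  by exists K.
by apply: ge_ereal_sup => _ [k Kk <-]; apply: uc.
Qed.

(* With N = 2^k this is N^(1/3) = exp (k ln 2 / 3) >= (k ln 2 / 6)^2. *)
Lemma exp2_powR_ge (R : realType) (k : nat) :
  (8 ^ k)%:R * (k%:R * (ln 2 / 6)) ^+ 2 <= (2 ^ k)%N%:R `^ (10 / 3) :> R.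
Proof.
have -> : (10 / 3 : R) = 3%:R + 3^-1 by field.
rewrite powRD ?pnatr_eq0 ?expn_eq0 ?implybT // powR_mulrn ?ler0n //.
rewrite -natrX -expnM mulnC expnM ler_wpM2l ?ler0n //.
rewrite /powR pnatr_eq0 expn_eq0 /= natrX lnXn ?ltr0n //.
have -> : 3^-1 * (ln 2 *+ k) = 2%:R * (k%:R * (ln 2 / 6)) :> R.
  by rewrite -[ln 2 *+ k]mulr_natl; field.
rewrite expRM_natl lerXn2r ?nnegrE ?expR_ge0 //.
  by rewrite !mulr_ge0 ?ler0n ?ln_ge0 ?ler1n ?invr_ge0.
by apply: le_trans (expR_ge1Dx _); rewrite lerDr.
Qed.

Theorem theorem5 (R : realType)
    (scan : nat -> seq (nat * nat))
    (scan_entries : forall n : nat, perm_eq (scan n) (entries n))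
    (arrange : seq nat -> seq nat)
    (arrange_perm : forall s : seq nat, perm_eq (arrange s) s) :
  (limn_esup (fun k : nat =>
     (dmd R (rmm_trace scan arrange k)
        / ((2 ^ k)%N%:R `^ (10 / 3)))%:E)
   < (1185 / 100 : R)%:E)%E.
Proof.
(* An eventual bound only yields a weak inequality, so a smaller constant is aimed at; any positive
   one would do, as the quotient tends to 0. *)
apply: (@le_lt_trans _ _ (11%:E)%E); last by rewrite lte_fin; lra.
have a_gt0 : 0 < ln 2 / 6 :> R by rewrite divr_gt0 ?ln_gt0 ?ltr1n ?ltr0n.
set a := (ln 2 / 6 : R) in a_gt0.
(* Beyond this threshold [160 * (k + 1) <= 320 * k <= 11 * (k * a) ^ 2], which is what remains after
   cancelling [8 ^ k]. *)
apply: (@limn_esup_le _ _ _ (Num.bound (320 / 11 / a ^+ 2)).+1) => k le_k.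
rewrite lee_fin ler_pdivrMr ?powR_gt0 ?ltr0n ?expn_gt0 //.
apply: (@le_trans _ _ (11 * ((8 ^ k)%:R * (k%:R * a) ^+ 2))); last first.
  by rewrite ler_wpM2l ?ler0n // exp2_powR_ge.
apply: le_trans (dmd_rmm_le _ _ scan_entries arrange_perm _ _ _ _ _) _.
rewrite natrM mulrCA mulrC ler_wpM2l ?ler0n //.
have k_gt : 320 / 11 / a ^+ 2 < k%:R.
  apply: lt_le_trans (archi_boundP _) _; first by rewrite !divr_ge0 ?sqr_ge0.
  by rewrite ler_nat ltnW.
have k_ge1 : 1 <= k%:R :> R by rewrite ler1n (leq_trans _ le_k).
rewrite ltr_pdivrMr ?exprn_gt0 // in k_gt.
rewrite natrM -(natr1 k) exprMn; nra.
Qed.
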